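(* Let $T\ge 1$, let $V_1,W_1,\dots,V_T,W_T$ be finite-dimensional quantum systems, $\tilde V := W_T\otimes V_T\otimes\cdots\otimes W_1\otimes V_1$, let $M\ge 1$, let $\mathcal{E}_1,\dots,\mathcal{E}_M\in\mathsf{Comb}_{W_T,V_T,\dots,W_1,V_1}$ and let $(p_1,\dots,p_M)$ be a probability vector. Let $\mathcal{P}$ be a nonempty subset of $\mathcal{P}_{\mathrm G}$. Let $\mathcal{C}$ be any closed convex cone and $\mathcal{S}$ any closed convex set such that $\mathcal{C}\subseteq \mathcal{C}_{\mathrm G}$, $\mathcal{S}\subseteq\mathcal{S}_{\mathrm G}$ and $$\overline{\mathrm{co}}\,\mathcal{P}=\Big\{\Phi\in\mathcal{C}:\ \textstyle\sum_{m=1}^M\Phi_m\in\mathcal{S}\Big\}.$$ Then $$\sup_{\Phi\in\mathcal{P}} P(\Phi)\;=\;\inf_{\chi\in\mathcal{D}_{\mathcal{C}}} D_{\mathcal{S}}(\chi),$$ i.e. the optimal values of Problem (P) and Problem (D) coincide.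
   Context: Notation: for a finite-dimensional system $X$, $\mathsf{Her}_X$, $\mathsf{Pos}_X$, $\mathsf{Den}_X$ are the Hermitian, positive semidefinite and density matrices on $X$, $I_X$ the identity, $\mathrm{Tr}_X$ the partial trace. On $\mathsf{Her}_{\tilde V}$ use $\langle A,B\rangle:=\mathrm{Tr}(AB)$. $\mathsf{Comb}_{W_T,V_T,\dots,W_1,V_1}$ is the set of $\tau\in\mathsf{Pos}_{\tilde V}$ for which there exist $\tau^{(t)}\in\mathsf{Pos}_{W_t\otimes V_t\otimes\cdots\otimes W_1\otimes V_1}$ ($1\le t\le T-1$) with $\mathrm{Tr}_{W_t}\tau^{(t)}=I_{V_t}\otimes\tau^{(t-1)}$ for all $1\le t\le T$, where $\tau^{(0)}:=1$, $\tau^{(T)}:=\tau$. $\mathsf{Comb}^*_{W_T,V_T,\dots,W_1,V_1}$ is the set of $\tau\in\mathsf{Pos}_{\tilde V}$ for which there exist $\tau^{(1)}\in\mathsf{Den}_{V_1}$ and $\tau^{(t)}\in\mathsf{Pos}_{V_t\otimes W_{t-1}\otimes V_{t-1}\otimes\cdots\otimes W_1\otimes V_1}$ ($2\le t\le T$) with $\tau=I_{W_T}\otimes\tau^{(T)}$ and $\mathrm{Tr}_{V_t}\tau^{(t)}=I_{W_{t-1}}\otimes\tau^{(t-1)}$ for $2\le t\le T$. Set $\mathcal{C}_{\mathrm G}:=\mathsf{Pos}_{\tilde V}^M$, $\mathcal{S}_{\mathrm G}:=\mathsf{Comb}^*_{W_T,V_T,\dots,W_1,V_1}$, and $\mathcal{P}_{\mathrm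 G}:=\{\Phi=(\Phi_1,\dots,\Phi_M)\in\mathcal{C}_{\mathrm G}:\sum_m\Phi_m\in\mathcal{S}_{\mathrm G}\}$ (the set of all testers). Elements $\Phi$ are viewed as vectors of the real space $\mathsf{Her}_{\tilde V}^M$; $\overline{\mathrm{co}}$ denotes the closure of the convex hull there. $P(\Phi):=\sum_{m=1}^M p_m\langle\Phi_m,\mathcal{E}_m\rangle$; Problem (P) is $\sup_{\Phi\in\mathcal{P}}P(\Phi)$. $\mathcal{D}_{\mathcal{C}}:=\{\chi\in\mathsf{Her}_{\tilde V}:\sum_{m=1}^M\langle\Phi_m,\chi-p_m\mathcal{E}_m\rangle\ge 0\ \ \forall\Phi\in\mathcal{C}\}$, $D_{\mathcal{S}}(\chi):=\max_{\varphi\in\mathcal{S}}\langle\varphi,\chi\rangle$, and Problem (D) is $\inf_{\chi\in\mathcal{D}_{\mathcal{C}}}D_{\mathcal{S}}(\chi)$. *)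

(* Defs.v *)
From HB Require Import structures.
From mathcomp Require Import all_boot all_order all_algebra.
From mathcomp Require Import classical_sets reals constructive_ereal ereal.
From mathcomp.real_closed Require Import complex.
Set Implicit Arguments. Unset Strict Implicit. Unset Printing Implicit Defensive.
Import Order.TTheory GRing.Theory Num.Theory.
Local Open Scope ring_scope.
Local Open Scope complex_scope.
Local Open Scope classical_set_scope.

(* Quantum systems.  A finite-dimensional system is C^X for a finite
   index type X (an orthonormal basis).  The systems V_t, W_t
   (1 <= t <= T) are given by families V W : nat -> finType.
   Sys V W t is the index type of  W_t (x) V_t (x) ... (x) W_1 (x) V_1,
   with Sys V W 0 = unit (the trivial one-dimensional system C).        *)
Fixpoint Sys (V W : nat -> finType) (t : nat) : finType :=
  match t with
  | 0 => Finite.clone unit _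
  | t'.+1 => Finite.clone (W t * (V t * Sys V W t'))%type _
  end.

Definition Op (R : realType) (I : Type) := I -> I -> R[i].

Section Ops.
Variable R : realType.

Definition hermitian (I : Type) (A : Op R I) : Prop :=
  forall i j, A j i = (A i j)^*.

Definition quadform (I : finType) (A : Op R I) (v : I -> R[i]) : R[i] :=
  \sum_(i : I) \sum_(j : I) (v i)^* * A i j * v j.

(* Pos_X : positive semidefinite matrices (order of R[i]: 0 <= z iff z is
   real and nonnegative). *)
Definition psd (I : finType) (A : Op R I) : Prop :=
  hermitian A /\ forall v : I -> R[i], 0 <= quadform A v.

Definition trace (I : finType) (A : Op R I) : R[i] := \sum_(i : I) A i i.

Definition density (I : finType) (A : Op R I) : Prop :=
  psd A /\ trace A = 1.

Definition idOp (I : finType) : Op R I := fun i j => (i == j)%:R.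

Definition oneOp : Op R unit := fun _ _ => 1.

Definition tens (X Y : finType) (A : Op R X) (B : Op R Y) : Op R (X * Y)%type :=
  fun i j => A i.1 j.1 * B i.2 j.2.

Definition ptr1 (X Y : finType) (A : Op R (X * Y)%type) : Op R Y :=
  fun y y' => \sum_(x : X) A (x, y) (x, y').

Definition opmul (I : finType) (A B : Op R I) : Op R I :=
  fun i j => \sum_(k : I) A i k * B k j.

(* <A,B> = Tr(AB)  (real for Hermitian A, B; we take the real part) *)
Definition inner (I : finType) (A B : Op R I) : R :=
  complex.Re (trace (opmul A B)).

End Ops.

Section Combs.
Variable R : realType.
Variables (V W : nat -> finType).

Definition Comb (T : nat) (tau : Op R (Sys V W T)) : Prop :=
  psd tau /\
  exists taus : forall t : nat, Op R (Sys V W t),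
    [/\ taus 0 = @oneOp R, taus T = tau,
        (forall t, (1 <= t <= T - 1)%N -> psd (taus t)) &
        (forall t, (t < T)%N -> ptr1 (taus t.+1) = tens (@idOp R (V t.+1)) (taus t))].

(* Comb^*_{W_T,V_T,...,W_1,V_1}, for T = n.+1 (i.e. T >= 1).
   taus t lives on V_t (x) W_{t-1} (x) V_{t-1} (x) ... (x) W_1 (x) V_1,
   for t = 1 this is V_1 (x) C. *)
Definition CombStar (n : nat) (tau : Op R (Sys V W n.+1)) : Prop :=
  psd tau /\
  exists taus : forall t : nat, Op R (V t * Sys V W t.-1)%type,
    [/\ density (taus 1%N),
        (forall t, (2 <= t <= n.+1)%N -> psd (taus t)),
        tau = tens (@idOp R (W n.+1)) (taus n.+1) &
        (forall t, (t.+2 <= n.+1)%N ->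
           ptr1 (taus t.+2) = tens (@idOp R (W t.+1)) (taus t.+1))].

End Combs.

(* Elementary real convex geometry in Her^M (resp. Her), entrywise.
   Closure is w.r.t. the entrywise max-distance (all norms are
   equivalent in finite dimension). *)
Section Convex.
Variable R : realType.
Variables (I : finType) (M : nat).

Definition Vec := 'I_M -> Op R I.

Definition closureO (A : Op R I -> Prop) (X : Op R I) : Prop :=
  forall eps : R, 0 < eps -> exists Y, A Y /\
    forall i j, `|X i j - Y i j| < eps%:C.
Definition closedO (A : Op R I -> Prop) : Prop :=
  forall X, closureO A X -> A X.
Definition convexO (A : Op R I -> Prop) : Prop :=
  forall X Y, A X -> A Y -> forall a : R, 0 <= a <= 1 ->
    A (fun i j => a%:C * X i j + (1 - a)%:C * Y i j).

Definition closureV (A : Vec -> Prop) (X : Vec) : Prop :=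
  forall eps : R, 0 < eps -> exists Y, A Y /\
    forall m i j, `|X m i j - Y m i j| < eps%:C.
Definition closedV (A : Vec -> Prop) : Prop :=
  forall X, closureV A X -> A X.
Definition convexV (A : Vec -> Prop) : Prop :=
  forall X Y, A X -> A Y -> forall a : R, 0 <= a <= 1 ->
    A (fun m i j => a%:C * X m i j + (1 - a)%:C * Y m i j).
Definition coneV (A : Vec -> Prop) : Prop :=
  forall X (a : R), A X -> 0 <= a -> A (fun m i j => a%:C * X m i j).
Definition convex_coneV (A : Vec -> Prop) : Prop := convexV A /\ coneV A.
Definition convhullV (A : Vec -> Prop) (X : Vec) : Prop :=
  exists (k : nat) (w : 'I_k -> R) (Y : 'I_k -> Vec),
    [/\ forall l, 0 <= w l, \sum_(l < k) w l = 1, forall l, A (Y l) &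
        forall m i j, X m i j = \sum_(l < k) (w l)%:C * Y l m i j].

Definition sumOp (X : Vec) : Op R I := fun i j => \sum_(m < M) X m i j.

End Convex.

Section Problems.
Variable R : realType.
Variables (V W : nat -> finType) (n M : nat).
Local Notation Vt := (Sys V W n.+1).

Definition CG (X : Vec R Vt M) : Prop := forall m, psd (X m).
Definition PG (X : Vec R Vt M) : Prop := CG X /\ @CombStar R V W n (sumOp X).

Variables (p : 'I_M -> R) (E : 'I_M -> Op R Vt).

Definition Pval (X : Vec R Vt M) : R := \sum_(m < M) p m * inner (X m) (E m).

Definition DualC (C : Vec R Vt M -> Prop) (chi : Op R Vt) : Prop :=
  hermitian chi /\
  forall X, C X ->
    0 <= \sum_(m < M) inner (X m) (fun i j => chi i j - (p m)%:C * E m i j).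

Definition DS (S : Op R Vt -> Prop) (chi : Op R Vt) : \bar R :=
  ereal_sup [set (inner phi chi)%:E | phi in S].

End Problems.

(* Main.v *)
(* The image {(sum_m Phi_m - phi, P(Phi)) : Phi in C, phi in S} is convex, and
   it is closed because every member of S has the same trace, so that for
   positive semidefinite Phi_m a bounded image forces (Phi, phi) to be bounded.
   For v >= sup (P) and eps > 0 it misses
   (0, v + eps); a strictly separating functional, normalised in its last
   coordinate, is given by some chi.  Since C is a cone, chi is dual feasible,
   and D_S(chi) <= v + eps. *)
Require Import Defs.
From HB Require Import structures.
From mathcomp Require Import all_boot all_order all_algebra.
From mathcomp Require Import boolp classical_sets reals constructive_ereal ereal.
From mathcomp Require Import topology normedtype derive.
From mathcomp.real_closed Require Import complex.
From mathcomp Require Import ring lra.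
Import Order.TTheory GRing.Theory Num.Theory.
Local Open Scope ring_scope.
Local Open Scope classical_set_scope.

(** * Strict separation of a point from the proper linear image of a closed convex set *)

Section Separation.
Import numFieldNormedType.Exports.
Variables (R : realType) (J : finType).
Implicit Types (x y : J -> R) (h : (J -> R) -> R).

Definition linear_form h :=
  forall a x y, h (fun j => a * x j + y j) = a * h x + h y.

Lemma linear_form0 h : linear_form h -> h (fun=> 0) = 0.
Proof.
move=> hl; transitivity (-1 * h (fun=> 0) + h (fun=> 0)); last by ring.
by rewrite -hl; congr h; apply/funext => j; rewrite mulr0 addr0.
Qed.

Lemma linear_formZ h a x : linear_form h -> h (fun j => a * x j) = a * h x.
Proof.
move=> hl; rewrite -[a * h x]addr0 -(linear_form0 h hl) -hl; congr h.
by apply/funext => j; rewrite addr0.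
Qed.

Lemma linear_form_coordE h : linear_form h ->
  exists a : J -> R, forall x, h x = \sum_j a j * x j.
Proof.
move=> hl; exists (fun j => h (fun i => (i == j)%:R)) => x.
suff: forall r : seq J, h (fun i => \sum_(j <- r) x j * (i == j)%:R) =
    \sum_(j <- r) h (fun i => (i == j)%:R) * x j.
  move=> <-; congr h; apply/funext => i.
  rewrite (bigD1 i) //= eqxx mulr1 big1 ?addr0 // => j.
  by rewrite eq_sym => /negPf ->; rewrite mulr0.
elim=> [|j r IH].
  rewrite big_nil -[RHS](linear_form0 h hl); congr h.
  by apply/funext => i; rewrite big_nil.
rewrite big_cons mulrC -IH -hl; congr h.
by apply/funext => i; rewrite big_cons.
Qed.

Lemma linear_form_continuous h : linear_form h ->
  continuous (h : prod_topology (fun _ : J => R) -> R).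
Proof.
move=> /linear_form_coordE[a ha]; have -> : h = fun x => \sum_j a j * x j.
  by apply/funext.
apply: continuous_big => [|j _ x]; first exact: add_continuous.
apply: (@continuousM R (prod_topology (fun _ : J => R)) (fun=> a j) (fun x => x j)).
  exact: cst_continuous.
exact: (@proj_continuous J (fun=> R) j x).
Qed.

Lemma box_compact (B : R) :
  @compact (prod_topology (fun _ : J => R)) [set x | forall j, `|x j| <= B].
Proof.
have -> : [set x : J -> R | forall j, `|x j| <= B] =
          [set x | forall j, `[-B, B]%classic (x j)].
  by apply/seteqP; split=> x /= xB j; have := xB j; rewrite in_itv /= ler_norml.
apply: (@tychonoff J (fun=> R) (fun=> `[-B, B])) => j; exact: segment_compact.
Qed.

(** Since [J] is finite, the uniform [e]-box around [x] is a neighbourhood in the product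
    topology. *)
Lemma closed_prod_topology (A : set (J -> R)) :
  (forall x, (forall e, 0 < e -> exists2 y, A y & forall j, `|x j - y j| < e) ->
     A x) ->
  @closed (prod_topology (fun _ : J => R)) A.
Proof.
move=> Acl x clx; apply: Acl => e e0.
have [] := clx [set y | forall j, `|x j - y j| < e].
  apply: (@filter_forall _ J (fun j y => `|x j - y j| < e) _
    (@nbhs_filter (prod_topology (fun _ : J => R)) x)) => j.
  exact: (@proj_continuous J (fun=> R) j x (ball (x j) e) (nbhsx_ballx _ _ e0)).
by move=> y [Ay yx]; exists y.
Qed.

(** The squared distance [f] from the image to [q] attains its minimum on [A], because properness
    bounds the sublevel set of [x0] and compactness applies there. At a minimiser [xm], the vector
    from [g xm] to [q] separates with gap [f xm]. *)
Lemma proper_image_separation (K : finType) (g : K -> (J -> R) -> R)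
    (q : K -> R) (A : set (J -> R)) :
  (forall k, linear_form (g k)) ->
  A !=set0 ->
  (forall x y a, A x -> A y -> 0 <= a <= 1 -> A (fun j => a * x j + (1 - a) * y j)) ->
  (forall x, (forall e, 0 < e -> exists2 y, A y & forall j, `|x j - y j| < e) ->
     A x) ->
  (forall B, exists B', forall x, A x -> (forall k, `|g k x| <= B) ->
     forall j, `|x j| <= B') ->
  (forall x, A x -> exists k, g k x != q k) ->
  exists c : K -> R, exists2 d, 0 < d &
    forall x, A x -> \sum_k c k * g k x + d <= \sum_k c k * q k.
Proof.
move=> gl [x0 Ax0] Acvx Acl Aprop Aq.
pose f x : R := \sum_k (g k x - q k) ^+ 2.
have f_ge k x : (g k x - q k) ^+ 2 <= f x.
  by rewrite /f (bigD1 k) //= lerDl sumr_ge0 // => i _; exact: sqr_ge0.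
(* If [0 <= t] and [t ^+ 2 <= f x0], then [t <= f x0 + 1]. *)
pose L := f x0 + 1.
have [B' hB'] := Aprop (\sum_k `|q k| + L).
have small x : A x -> f x <= f x0 -> forall j, `|x j| <= B'.
  move=> Ax fx; apply: hB' => // k.
  have h1 : `|q k| <= \sum_k `|q k| by rewrite (bigD1 k) //= lerDl sumr_ge0.
  have h2 : `|g k x| <= `|g k x - q k| + `|q k|.
    by rewrite -[X in `|X| <= _](subrK (q k)) ler_normD.
  have h3 : `|g k x - q k| <= L.
    have := le_trans (f_ge k x) fx; rewrite -real_normK ?num_real // /L.
    have := normr_ge0 (g k x - q k); nra.
  lra.
have cA : @compact (prod_topology (fun _ : J => R)) (A `&` [set x | forall j, `|x j| <= B']).
  apply: (subclosed_compact _ (@box_compact B')); last by move=> x [].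
  apply: closed_prod_topology => x xcl; split.
    by apply: Acl => e /xcl[y [Ay _]]; exists y.
  move=> j; apply/ler_addgt0Pr => e /xcl[y [_ yB] /(_ j) xy].
  have := yB j; have : `|x j| <= `|x j - y j| + `|y j|.
    by rewrite -[X in `|X| <= _](subrK (y j)) ler_normD.
  lra.
have fc : continuous (f : prod_topology (fun _ : J => R) -> R).
  have gc k : continuous ((fun x => g k x - q k) : prod_topology (fun _ : J => R) -> R).
    move=> x; apply: (@continuousB R R (prod_topology (fun _ : J => R))).
      exact: linear_form_continuous.
    exact: cst_continuous.
  apply: continuous_big => [|k _ x]; first exact: add_continuous.
  exact: (@continuousM R (prod_topology (fun _ : J => R)) _ _ x (gc k x) (gc k x)).
have [|xm xmA xmin] := compact_EVT_min _ cA (continuous_subspaceT fc).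
  by exists x0; split => //; exact: small.
have [Axm xmB] := set_mem xmA.
(* The minimum over the box is global on [A]: wherever [f] exceeds [f x0], it also exceeds
   [f xm]. *)
have {xmA xmB}xmin y : A y -> f xm <= f y.
  move=> Ay; have [fy|fy] := lerP (f y) (f x0).
    by apply: xmin; apply/mem_set; split => //; exact: small.
  apply: le_trans (ltW fy); apply: xmin; apply/mem_set; split => //.
  exact: small.
have fxm : 0 < f xm.
  have [k gk] := Aq _ Axm; apply: lt_le_trans (f_ge k xm).
  by rewrite exprn_even_gt0 //= subr_eq0.
exists (fun k => q k - g k xm); exists (f xm) => // y Ay.
pose D := \sum_k (g k xm - q k) * (g k y - g k xm).
pose Q := \sum_k (g k y - g k xm) ^+ 2.
have Q0 : 0 <= Q by apply: sumr_ge0 => k _; exact: sqr_ge0.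
have fE t : f (fun j => t * y j + (1 - t) * xm j) = f xm + 2 * t * D + t ^+ 2 * Q.
  rewrite /f /D /Q !mulr_sumr -!big_split /=; apply: eq_bigr => k _.
  rewrite (gl k) linear_formZ //; ring.
have D0 : 0 <= D.
  rewrite leNgt; apply/negP => D0.
  (* This [t] gives [t ^+ 2 * Q <= - t * D], so moving from [xm] towards [y] changes [f] by at most
     [t * D < 0], against minimality. *)
  pose t := Num.min 1 (- D / (Q + 1)).
  have t0 : 0 < t by rewrite lt_min ltr01 divr_gt0 //; lra.
  have t1 : t <= 1 by rewrite ge_min lexx.
  have t2 : t * (Q + 1) <= - D by rewrite -ler_pdivlMr ?ge_min ?lexx ?orbT //; lra.
  have := xmin _ (Acvx _ _ t Ay Axm _); rewrite fE => /(_ _).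
  rewrite (ltW t0) t1 => /(_ isT); nra.
have -> : \sum_k (q k - g k xm) * q k =
    \sum_k (q k - g k xm) * g k y + D + f xm.
  rewrite /D /f -!big_split /=; apply: eq_bigr => k _; ring.
lra.
Qed.

End Separation.

(** * Real pairing, real coordinates and trace bounds for complex matrices *)

Section Operators.
Local Open Scope complex_scope.
Variable R : realType.

Lemma Re_sum (I : Type) (r : seq I) (Q : pred I) (F : I -> R[i]) :
  complex.Re (\sum_(i <- r | Q i) F i) = \sum_(i <- r | Q i) complex.Re (F i).
Proof. by apply: big_morph => // -[a b] [c d]. Qed.

Lemma Im_sum (I : Type) (r : seq I) (Q : pred I) (F : I -> R[i]) :
  complex.Im (\sum_(i <- r | Q i) F i) = \sum_(i <- r | Q i) complex.Im (F i).
Proof. by apply: big_morph => // -[a b] [c d]. Qed.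

Lemma real_scaleE (a : R) (z : R[i]) :
  a%:C * z = (a * complex.Re z) +i* (a * complex.Im z).
Proof. by case: z => x y; apply/eqP; rewrite eq_complex /= !mul0r subr0 addr0 !eqxx. Qed.

(* The conjugation is [Num.conj] in [quadform] but [conjc] in [hermitian]. *)
Lemma conjCE (z : R[i]) : Num.conj z = conjc z.
Proof. by []. Qed.

Lemma Re_ge0 (z : R[i]) : 0 <= z -> 0 <= complex.Re z.
Proof. by rewrite lecE => /andP[]. Qed.

Lemma Re_lt_norm (z : R[i]) (e : R) : `|z| < e%:C -> `|complex.Re z| < e.
Proof. by move=> ze; rewrite -ltcR; exact: le_lt_trans (normc_ge_Re z) ze. Qed.

Lemma Im_lt_norm (z : R[i]) (e : R) : `|z| < e%:C -> `|complex.Im z| < e.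
Proof.
move=> ze; rewrite -normrN -ReiNIm; apply: Re_lt_norm.
have -> : `|z * 'i| = `|z|; last by [].
by rewrite !normc_def; case: z {ze} => a b /=; congr (Num.sqrt _)%:C; ring.
Qed.

Lemma norm_lt_coord (z : R[i]) (e : R) :
  `|complex.Re z| < e / 2 -> `|complex.Im z| < e / 2 -> `|z| < e%:C.
Proof.
move=> h1 h2; have e0 : 0 < e by have := normr_ge0 (complex.Re z); lra.
rewrite normc_def ltcR -[ltRHS]ger0_norm ?ltW // -sqrtr_sqr ltr_sqrt ?exprn_gt0 //.
rewrite -(real_normK (num_real (complex.Re z))) -(real_normK (num_real (complex.Im z))).
have := normr_ge0 (complex.Re z); have := normr_ge0 (complex.Im z); nra.
Qed.

Lemma sum_option (K : finType) (F : option K -> R) :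
  \sum_k F k = F None + \sum_k F (Some k).
Proof.
rewrite (bigD1 None) //=; congr (_ + _).
rewrite (reindex_omap Some id) => [|[]] //=.
by apply: eq_bigl => k; rewrite eqxx.
Qed.

Section OneSystem.
Variable I : finType.
Implicit Types (A B X : Op R I).

Lemma innerE A B : inner A B = \sum_i \sum_j
  (complex.Re (A i j) * complex.Re (B j i) - complex.Im (A i j) * complex.Im (B j i)).
Proof.
rewrite /inner /trace Re_sum; apply: eq_bigr => i _; rewrite Re_sum.
by apply: eq_bigr => j _; case: (A i j); case: (B j i).
Qed.

Lemma inner_suml (L : Type) (r : seq L) (w : L -> R) (Y : L -> Op R I) B :
  inner (fun i j => \sum_(l <- r) (w l)%:C * Y l i j) B = \sum_(l <- r) w l * inner (Y l) B.
Proof.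
rewrite innerE; under [RHS]eq_bigr do rewrite innerE mulr_sumr.
rewrite [RHS]exchange_big /=; apply: eq_bigr => i _.
under [RHS]eq_bigr do rewrite mulr_sumr.
rewrite [RHS]exchange_big /=; apply: eq_bigr => j _.
rewrite Re_sum Im_sum !mulr_suml -sumrB; apply: eq_bigr => l _.
rewrite real_scaleE /=; ring.
Qed.

Lemma innerDZl a A X B : inner (fun i j => a%:C * A i j + X i j) B = a * inner A B + inner X B.
Proof.
rewrite !innerE mulr_sumr -big_split /=; apply: eq_bigr => i _ /=.
rewrite mulr_sumr -big_split /=; apply: eq_bigr => j _ /=.
rewrite real_scaleE; case: (X i j) => x y /=; ring.
Qed.

Lemma innerZl a A B : inner (fun i j => a%:C * A i j) B = a * inner A B.
Proof.
rewrite !innerE mulr_sumr; apply: eq_bigr => i _ /=.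
rewrite mulr_sumr; apply: eq_bigr => j _ /=.
rewrite real_scaleE /=; ring.
Qed.

Lemma innerBZr a X A B : inner X (fun i j => A i j - a%:C * B i j) = inner X A - a * inner X B.
Proof.
rewrite !innerE mulr_sumr -sumrB; apply: eq_bigr => i _ /=.
rewrite mulr_sumr -sumrB; apply: eq_bigr => j _ /=.
rewrite real_scaleE; case: (A j i) => x y /=; ring.
Qed.

Lemma inner_sumOp M (X : Vec R I M) B : inner (sumOp X) B = \sum_m inner (X m) B.
Proof.
transitivity (inner (fun i j => \sum_m (1 : R)%:C * X m i j) B).
  congr inner; apply/funext => i; apply/funext => j.
  by apply: eq_bigr => m _; rewrite mul1r.
by rewrite inner_suml; apply: eq_bigr => m _; rewrite mul1r.
Qed.

(** The pairing is Lipschitz in its first argument, with the entrywise l1 size of [B] as constant;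
    this carries upper bounds to closures. *)
Lemma inner_perturb A X B (e : R) : 0 <= e ->
  (forall i j, `|A i j - X i j| < e%:C) ->
  inner A B <= inner X B +
    e * \sum_i \sum_j (`|complex.Re (B j i)| + `|complex.Im (B j i)|).
Proof.
move=> e0 AX; rewrite !innerE mulr_sumr -big_split /=; apply: ler_sum => i _.
rewrite mulr_sumr -big_split /=; apply: ler_sum => j _ /=.
have /Re_lt_norm := AX i j; have /Im_lt_norm := AX i j.
case: (A i j) => a a'; case: (X i j) => x x'; case: (B j i) => b b' /=.
move=> /ltW h2 /ltW h1.
have k1 : (a - x) * b <= e * `|b|.
  by apply: le_trans (ler_norm _) _; rewrite normrM ler_wpM2r.
have k2 : - ((a' - x') * b') <= e * `|b'|.
  by apply: le_trans (ler_norm _) _; rewrite normrN normrM ler_wpM2r.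
lra.
Qed.

Definition opcoord X (k : I * I * bool) : R :=
  if k.2 then complex.Im (X k.1.1 k.1.2) else complex.Re (X k.1.1 k.1.2).

(* Averaging a representing matrix with its adjoint does not change its
   pairing with Hermitian matrices. *)
Lemma hermitian_representer (c : I * I * bool -> R) :
  exists2 chi : Op R I, Defs.hermitian chi &
    forall X, Defs.hermitian X -> inner X chi = \sum_k c k * opcoord X k.
Proof.
exists (fun i j =>
  ((c (i, j, false) + c (j, i, false)) / 2) +i* ((c (i, j, true) - c (j, i, true)) / 2)).
  by move=> i j; apply/eqP; rewrite eq_complex /=; apply/andP; split; apply/eqP; field.
move=> X hX; rewrite innerE.
pose F i j := c (i, j, false) * complex.Re (X i j) + c (i, j, true) * complex.Im (X i j).
have -> : \sum_k c k * opcoord X k = \sum_i \sum_j F i j.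
  pose G (ij : I * I) b := c (ij, b) * opcoord X (ij, b).
  rewrite pair_big /=; transitivity (\sum_ij \sum_b G ij b).
    by rewrite pair_big; apply: eq_bigr => -[].
  by apply: eq_bigr => -[i j] _; rewrite big_bool /G /F /opcoord /= addrC.
(* After symmetrising, the two sums agree term by term once [X j i] is replaced by the conjugate of
   [X i j]. *)
have -> : \sum_i \sum_j F i j = \sum_i \sum_j (F i j + F j i) / 2.
  transitivity ((\sum_i \sum_j F i j + \sum_i \sum_j F j i) / 2).
    by rewrite [\sum_i \sum_j F j i]exchange_big /=; field.
  rewrite -big_split mulr_suml; apply: eq_bigr => i _ /=.
  by rewrite -big_split mulr_suml.
apply: eq_bigr => i _; apply: eq_bigr => j _; rewrite /F /= (hX i j).
by case: (X i j) => x y /=; field.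
Qed.

Lemma sum_two_points (f : I -> R[i]) i j (b : R[i]) :
  \sum_k ((k == i)%:R + b * (k == j)%:R) * f k = f i + b * f j.
Proof.
under eq_bigr do rewrite mulrDl; rewrite big_split /=; congr (_ + _).
  rewrite (bigD1 i) //= eqxx mul1r big1 ?addr0 // => k /negPf ->.
  by rewrite mul0r.
rewrite (bigD1 j) //= eqxx mulr1 big1 ?addr0 // => k /negPf ->.
by rewrite mulr0 mul0r.
Qed.

(** The test vector is [e_i + b e_j], with [i = j] allowed, so diagonal and off-diagonal entries are
    reached by the same formula. *)
Lemma quadform_two_points A i j (b : R[i]) :
  quadform A (fun k => (k == i)%:R + b * (k == j)%:R) =
  A i i + b * A i j + b^* * (A j i + b * A j j).
Proof.
rewrite /quadform; pose v k : R[i] := (k == i)%:R + b * (k == j)%:R.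
transitivity (\sum_k ((k == i)%:R + b^* * (k == j)%:R) * (A k i + b * A k j)).
  apply: eq_bigr => k _; rewrite -/(v k) -[A k i + _](sum_two_points (A k)).
  rewrite mulr_sumr; apply: eq_bigr => l _; rewrite -/(v l).
  rewrite -mulrA [A k l * _]mulrC; congr (_ * _).
  by rewrite /v rmorphD rmorphM /= !rmorph_nat.
exact: sum_two_points.
Qed.

Lemma psd_diag_ge0 A i : psd A -> 0 <= complex.Re (A i i).
Proof.
case=> _ /(_ (fun k => (k == i)%:R + 0 * (k == i)%:R)).
by rewrite quadform_two_points rmorph0 !mul0r !addr0 => /Re_ge0.
Qed.

Lemma Re_trace A : complex.Re (trace A) = \sum_i complex.Re (A i i).
Proof. exact: Re_sum. Qed.

Lemma psd_diag_le_trace A i : psd A -> complex.Re (A i i) <= complex.Re (trace A).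
Proof.
move=> pA; rewrite Re_trace (bigD1 i) //= lerDl sumr_ge0 // => j _.
exact: psd_diag_ge0.
Qed.

(** Testing [e_i + z e_j] with [z = 1, -1, i, -i] bounds both parts of [A i j] by the average of the
    two diagonal entries. Each of these is at most the trace, so [i = j] needs no separate case. *)
Lemma psd_coord_le_trace A k : psd A -> `|opcoord A k| <= complex.Re (trace A).
Proof.
move=> pA; case: k => -[i j] b; rewrite /opcoord /=.
have := psd_diag_le_trace A i pA; have := psd_diag_le_trace A j pA.
have q z : 0 <= complex.Re (A i i + z * A i j + conjc z * (A j i + z * A j j)).
  by rewrite -conjCE -quadform_two_points; apply: Re_ge0; case: pA.
have := q 1; have := q (-1); have := q 'i%C; have := q (- 'i%C).
rewrite (proj1 pA i j) ler_norml.
case: (A i i) => d d'; case: (A j j) => f f'; case: (A i j) => x y.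
by case: b => /= h1 h2 h3 h4 h5 h6; apply/andP; split; lra.
Qed.

Lemma psd_trace_le_sum M (X : Vec R I M) m : (forall m', psd (X m')) ->
  complex.Re (trace (X m)) <= complex.Re (trace (sumOp X)).
Proof.
move=> pX; have -> : complex.Re (trace (sumOp X)) = \sum_m' complex.Re (trace (X m')).
  rewrite Re_trace; under [RHS]eq_bigr do rewrite Re_trace.
  by rewrite exchange_big /=; apply: eq_bigr => i _; rewrite Re_sum.
rewrite (bigD1 m) //= lerDl sumr_ge0 // => m' _.
by rewrite Re_trace sumr_ge0 // => i _; exact: psd_diag_ge0.
Qed.

End OneSystem.

(** * The common trace of all members of [CombStar] *)

Lemma trace_ptr1 (X Y : finType) (A : Op R (X * Y)%type) : trace (ptr1 A) = trace A.
Proof.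
by rewrite /trace /ptr1 exchange_big pair_big; apply: eq_bigr => -[x y].
Qed.

Lemma trace_tens (X Y : finType) (A : Op R X) (B : Op R Y) :
  trace (tens A B) = trace A * trace B.
Proof. by rewrite /trace /tens mulr_suml; under [RHS]eq_bigr do rewrite mulr_sumr; rewrite pair_big. Qed.

Lemma trace_idOp (X : finType) : trace (@idOp R X) = #|X|%:R.
Proof. by rewrite /trace /idOp; under eq_bigr do rewrite eqxx; rewrite sumr_const. Qed.

(** Partial traces preserve the trace and each identity factor multiplies it by a dimension,
    starting from a density matrix of trace 1. *)
Lemma CombStar_trace (V W : nat -> finType) n (tau : Op R (Sys V W n.+1)) :
  @CombStar R V W n tau -> trace tau = \prod_(t < n.+1) #|W t.+1|%:R.
Proof.
case=> _ [taus [[_ t1] _ -> tr]].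
(* At [taus t.+1] only the dimensions of [W_1] to [W_t] have entered; that of [W n.+1] comes from
   [tau] itself. *)
have H t : (t <= n)%N -> trace (taus t.+1) = \prod_(s < t) #|W s.+1|%:R.
  elim: t => [|t IH] tn; first by rewrite big_ord0.
  rewrite -trace_ptr1 tr // [LHS](trace_tens _ _ (@idOp R (W t.+1)) (taus t.+1)).
  by rewrite trace_idOp IH ?(ltnW tn) // big_ord_recr mulrC.
rewrite [LHS](trace_tens _ _ (@idOp R (W n.+1)) (taus n.+1)) trace_idOp H //.
by rewrite big_ord_recr mulrC.
Qed.

End Operators.

(** * Weak duality, and strong duality up to [e] *)

Section Duality.
Local Open Scope complex_scope.
Variables (R : realType) (V W : nat -> finType) (n M : nat).
Local Notation I := (Sys V W n.+1).
Variables (p : 'I_M -> R) (E : 'I_M -> Op R I).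
Implicit Types (X Y : Vec R I M) (phi : Op R I).

Lemma Pval_sum (L : Type) (r : seq L) (w : L -> R) (Y : L -> Vec R I M) :
  Pval p E (fun m i j => \sum_(l <- r) (w l)%:C * Y l m i j) =
  \sum_(l <- r) w l * Pval p E (Y l).
Proof.
rewrite /Pval; under [RHS]eq_bigr do rewrite mulr_sumr.
rewrite [RHS]exchange_big /=; apply: eq_bigr => m _.
by rewrite inner_suml mulr_sumr; apply: eq_bigr => l _; rewrite mulrCA.
Qed.

Lemma PvalDZ a X Y :
  Pval p E (fun m i j => a%:C * X m i j + Y m i j) = a * Pval p E X + Pval p E Y.
Proof.
rewrite /Pval mulr_sumr -big_split; apply: eq_bigr => m _ /=.
by rewrite innerDZl; ring.
Qed.

Lemma PvalZ a X : Pval p E (fun m i j => a%:C * X m i j) = a * Pval p E X.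
Proof.
rewrite /Pval mulr_sumr; apply: eq_bigr => m _.
by rewrite innerZl mulrCA.
Qed.

(** Linearity of the objective carries the bound to convex combinations, and its Lipschitz
    continuity carries it to the closure. *)
Lemma Pval_le_closure_convhull (P : Vec R I M -> Prop) (v : R) :
  (forall m, 0 <= p m) -> (forall X, P X -> Pval p E X <= v) ->
  forall X, closureV (convhullV P) X -> Pval p E X <= v.
Proof.
move=> p0 Pv X clX; apply/ler_addgt0Pr => e e0.
pose K m := \sum_i \sum_j (`|complex.Re (E m j i)| + `|complex.Im (E m j i)|).
have K0 m : 0 <= K m.
  by apply: sumr_ge0 => i _; apply: sumr_ge0 => j _; rewrite addr_ge0.
pose Q := \sum_m p m * K m.
have Q0 : 0 <= Q by apply: sumr_ge0 => m _; rewrite mulr_ge0.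
(* [Q] is a Lipschitz constant of the objective; dividing by [Q + 1] covers [Q = 0] and keeps the
   error below [e]. *)
have d0 : 0 < e / (Q + 1) by rewrite divr_gt0 //; lra.
have [Y [[k [w [Z [w0 w1 PZ YE]]]] XY]] := clX _ d0.
have Yv : Pval p E Y <= v.
  have -> : Y = fun m i j => \sum_(l < k) (w l)%:C * Z l m i j.
    by apply/funext => m; apply/funext => i; apply/funext => j.
  rewrite Pval_sum -[v]mul1r -w1 mulr_suml; apply: ler_sum => l _.
  by rewrite ler_wpM2l // Pv.
have : Pval p E X <= Pval p E Y + e / (Q + 1) * Q.
  rewrite /Pval /Q mulr_sumr -big_split; apply: ler_sum => m _ /=.
  rewrite mulrCA -mulrDr ler_wpM2l //; apply: inner_perturb => //; exact: ltW.
have : e / (Q + 1) * Q <= e by rewrite mulrAC ler_pdivrMr; nra.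
lra.
Qed.

(** Dual feasibility bounds the objective by the pairing of [sumOp X] with [chi], and [sumOp X]
    competes in the supremum [DS S chi]. *)
Lemma weak_duality (C : Vec R I M -> Prop) (S : Op R I -> Prop) X chi :
  C X -> S (sumOp X) -> DualC p E C chi -> ((Pval p E X)%:E <= DS S chi)%E.
Proof.
move=> CX SX [_ /(_ _ CX) h]; apply: (@le_trans _ _ (inner (sumOp X) chi)%:E).
  rewrite lee_fin inner_sumOp -subr_ge0 /Pval -sumrB; apply: le_trans h _.
  by apply: ler_sum => m _; rewrite innerBZr.
by apply: ereal_sup_ubound; exists (sumOp X).
Qed.

(* Real coordinates of a pair (X, phi): slot [Some m] holds X m and slot
   [None] holds phi. *)
Local Notation J := (option 'I_M * (I * I * bool))%type.

Definition slot (x : J -> R) (o : option 'I_M) : Op R I :=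
  fun i j => x (o, (i, j, false)) +i* x (o, (i, j, true)).

Definition tuple_part (x : J -> R) : Vec R I M := fun m => slot x (Some m).

Definition coords X phi : J -> R :=
  fun j => opcoord _ _ (if j.1 is Some m then X m else phi) j.2.

Lemma slot_coords X phi o : slot (coords X phi) o = if o is Some m then X m else phi.
Proof.
apply/funext => i; apply/funext => j; rewrite /slot /coords /opcoord /=.
by case: o => [m|]; [case: (X m i j)|case: (phi i j)].
Qed.

Lemma tuple_part_coords X phi : tuple_part (coords X phi) = X.
Proof. by apply/funext => m; rewrite /tuple_part slot_coords. Qed.

Lemma coord_slot x o k : opcoord _ _ (slot x o) k = x (o, k).
Proof. by case: k => -[i j] []. Qed.

Lemma slotDZ a x y o : slot (fun j => a * x j + y j) o =
  fun i j => a%:C * slot x o i j + slot y o i j.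
Proof.
by apply/funext => i; apply/funext => j; rewrite real_scaleE.
Qed.

Lemma slotDZZ a b x y o : slot (fun j => a * x j + b * y j) o =
  fun i j => a%:C * slot x o i j + b%:C * slot y o i j.
Proof.
by apply/funext => i; apply/funext => j; rewrite !real_scaleE.
Qed.

Lemma slot_close (x y : J -> R) (e : R) o i j :
  (forall k, `|x k - y k| < e / 2) -> `|slot x o i j - slot y o i j| < e%:C.
Proof. by move=> xy; apply: norm_lt_coord; apply: xy. Qed.

Lemma coord_sumOp X k : opcoord _ _ (sumOp X) k = \sum_m opcoord _ _ (X m) k.
Proof. by case: k => -[i j] []; rewrite /opcoord /sumOp /= ?Re_sum ?Im_sum. Qed.

Lemma hermitian_sumOp X : (forall m, Defs.hermitian (X m)) -> Defs.hermitian (sumOp X).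
Proof.
move=> hX i j; rewrite /sumOp -conjCE rmorph_sum.
by apply: eq_bigr => m _; rewrite /= conjCE -hX.
Qed.

(** The uniform trace bound [B0] on [S] supplies properness; the slack [e] keeps the target off the
    image, so separation is strict. *)
Lemma strong_duality (C : Vec R I M -> Prop) (S : Op R I -> Prop) (B0 v e : R) :
  closedV C -> convex_coneV C -> closedO S -> convexO S ->
  (forall X, C X -> CG X) ->
  (forall phi, S phi -> psd phi /\ complex.Re (trace phi) <= B0) ->
  (exists2 X, C X & S (sumOp X)) ->
  (forall X, C X -> S (sumOp X) -> Pval p E X <= v) -> 0 < e ->
  exists2 chi, DualC p E C chi & forall phi, S phi -> inner phi chi <= v + e.
Proof.
move=> Ccl [Ccvx Ccone] Scl Scvx CCG Sbd [X0 CX0 SX0] Cv e0.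
(* The tuple and [phi] vary independently in [A]; their coupling [sumOp X = phi] is moved into the
   [Some] coordinates of [g], while [None] carries the objective. *)
pose A := [set x : J -> R | C (tuple_part x) /\ S (slot x None)].
pose g (k : option (I * I * bool)) (x : J -> R) : R :=
  if k is Some k then \sum_m x (Some m, k) - x (None, k) else Pval p E (tuple_part x).
pose q (k : option (I * I * bool)) : R := if k is Some _ then 0 else v + e.
have A_coords X phi : C X -> S phi -> A (coords X phi).
  by move=> CX Sphi; rewrite /A /= tuple_part_coords slot_coords.
have [||||||c [d d0 cd]] := @proper_image_separation R _ _ g q A.
- case=> [k|] a x y /=; last first.
    rewrite -PvalDZ; congr Pval; apply/funext => m; exact: slotDZ.
  rewrite big_split /= mulrBr mulr_sumr; ring.
- by exists (coords X0 (sumOp X0)); exact: A_coords.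
- move=> x y a [Cx Sx] [Cy Sy] a01; split.
    have -> : tuple_part (fun j => a * x j + (1 - a) * y j) = fun m i j =>
        a%:C * tuple_part x m i j + (1 - a)%:C * tuple_part y m i j.
      by apply/funext => m; exact: slotDZZ.
    exact: Ccvx.
  rewrite slotDZZ; exact: Scvx.
- move=> x xcl; split.
    apply: Ccl => d d0; have [|y [Cy _] xy] := xcl (d / 2); first by rewrite divr_gt0.
    by exists (tuple_part y); split => // m i j; exact: slot_close.
  apply: Scl => d d0; have [|y [_ Sy] xy] := xcl (d / 2); first by rewrite divr_gt0.
  by exists (slot y None); split => // i j; exact: slot_close.
(* The trace of the sum is that of [phi] plus the diagonal coordinates of the difference, each at
   most [B]; it dominates the trace of every summand, hence all coordinates. *)
- move=> B; exists (B0 + \sum_(i : I) B) => x [Cx Sx] gB [o k].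
  have [psdx trx] := Sbd _ Sx.
  have ltr : complex.Re (trace (sumOp (tuple_part x))) <= B0 + \sum_(i : I) B.
    have -> : complex.Re (trace (sumOp (tuple_part x))) =
        complex.Re (trace (slot x None)) + \sum_i g (Some (i, i, false)) x.
      rewrite !Re_trace -big_split /=; apply: eq_bigr => i _.
      by rewrite /sumOp Re_sum /=; ring.
    apply: lerD => //; apply: ler_sum => i _.
    exact: le_trans (ler_norm _) (gB _).
  have B0s : B0 <= B0 + \sum_(i : I) B.
    rewrite lerDl sumr_ge0 // => i _; exact: le_trans (normr_ge0 _) (gB None).
  rewrite -coord_slot; case: o => [m|].
    apply: le_trans (psd_coord_le_trace _ _ _ _ (CCG _ Cx m)) _.
    exact: le_trans (psd_trace_le_sum _ _ _ _ m (CCG _ Cx)) ltr.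
  apply: le_trans (psd_coord_le_trace _ _ _ _ psdx) _; exact: le_trans trx B0s.
(* Hitting [q] would give a primal feasible tuple of value [v + e], above the bound [v]. *)
- move=> x [Cx Sx]; apply: contrapT => /forallNP gq.
  have {}gq k : g k x = q k by have /negP := gq k; rewrite negbK => /eqP.
  have E1 : slot x None = sumOp (tuple_part x).
    have key k : opcoord _ _ (slot x None) k = opcoord _ _ (sumOp (tuple_part x)) k.
      rewrite coord_sumOp; under eq_bigr do rewrite coord_slot.
      by have := gq (Some k); rewrite /= coord_slot => /eqP; rewrite subr_eq0 => /eqP.
    apply/funext => i; apply/funext => j; apply/eqP; rewrite eq_complex.
    by have := key (i, j, false); have := key (i, j, true); rewrite /opcoord /= => -> ->; rewrite !eqxx.
  have := Cv _ Cx; rewrite -E1 => /(_ Sx).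
  have /= -> := gq None; lra.
pose s := c None.
have sep X phi : C X -> S phi -> s * Pval p E X +
    \sum_k c (Some k) * (opcoord _ _ (sumOp X) k - opcoord _ _ phi k) + d <= s * (v + e).
  move=> CX Sphi; have := cd _ (A_coords _ _ CX Sphi).
  rewrite !sum_option /= tuple_part_coords -/s [\sum_k _ * 0]big1 => [|k _]; last by rewrite mulr0.
  rewrite addr0; apply: le_trans; rewrite lerD2r lerD2l le_eqVlt; apply/orP; left.
  by apply/eqP; apply: eq_bigr => k _; rewrite coord_sumOp.
(* At [phi = sumOp X0] the difference terms vanish, leaving [d <= s * (v + e - Pval p E X0)] with a
   positive second factor: a feasible point excludes a vertical hyperplane. *)
have s0 : 0 < s.
  have := sep _ _ CX0 SX0; rewrite big1 => [|k _]; last by rewrite subrr mulr0.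
  have := Cv _ CX0 SX0; nra.
(* Dividing by [s] gives the objective coefficient 1; the sign makes [chi] act as a multiplier on
   [sumOp X - phi]. *)
have [chi hchi chiE] := hermitian_representer _ _ (fun k => - c (Some k) / s).
have key X phi : C X -> S phi ->
    Pval p E X - inner (sumOp X) chi + inner phi chi <= v + e.
  move=> CX Sphi; have := sep _ _ CX Sphi.
  have hX : Defs.hermitian (sumOp X).
    by apply: hermitian_sumOp => m; case: (CCG _ CX m).
  have hphi : Defs.hermitian phi by case: (Sbd _ Sphi) => -[].
  have -> : \sum_k c (Some k) * (opcoord _ _ (sumOp X) k - opcoord _ _ phi k) =
      s * (inner phi chi - inner (sumOp X) chi).
    rewrite !chiE // -sumrB mulr_sumr; apply: eq_bigr => k _; field.
    by rewrite gt_eqF.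
  move=> h; rewrite -(ler_pM2l s0); lra.
(* A positive difference [u] could be scaled up inside the cone: the multiple [a] with
   [a * u = |kap| + 1] violates the bound [a * u <= kap] given by [key] at [phi = sumOp X0]. *)
have Pinner0 X : C X -> Pval p E X <= inner (sumOp X) chi.
  move=> CX; rewrite leNgt; apply/negP => lt.
  pose u := Pval p E X - inner (sumOp X) chi.
  pose kap := v + e - inner (sumOp X0) chi.
  have u0 : 0 < u by rewrite subr_gt0.
  pose a := (`|kap| + 1) / u.
  have a0 : 0 <= a by apply: divr_ge0; [rewrite addr_ge0|exact: ltW].
  have := key _ _ (Ccone _ a CX a0) SX0.
  have au : a * u = `|kap| + 1 by rewrite divfK ?gt_eqF.
  rewrite PvalZ inner_sumOp; under eq_bigr do rewrite innerZl.
  rewrite -mulr_sumr -inner_sumOp -mulrBr -/u au => h.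
  have := ler_norm kap; rewrite {1}/kap; lra.
exists chi.
  split=> // X CX; under eq_bigr do rewrite innerBZr.
  by rewrite sumrB subr_ge0 -inner_sumOp; exact: Pinner0.
(* The zero tuple, obtained as 0 times [X0], reduces [key] to the bound on [inner phi chi]. *)
move=> phi Sphi; have := key _ _ (Ccone _ 0 CX0 (lexx _)) Sphi.
rewrite PvalZ inner_sumOp; under eq_bigr do rewrite innerZl mul0r.
by rewrite sumr_const mul0rn mul0r subr0 add0r.
Qed.

End Duality.

(* T = n.+1 >= 1 *)
Theorem theorem1 (R : realType) (n : nat) (V W : nat -> finType)
  (M : nat) (hM : (0 < M)%N)
  (E : 'I_M -> Op R (Sys V W n.+1))
  (hE : forall m, @Comb R V W n.+1 (E m))
  (p : 'I_M -> R) (hp0 : forall m, 0 <= p m) (hp1 : \sum_(m < M) p m = 1)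
  (P : Vec R (Sys V W n.+1) M -> Prop)
  (hPne : exists X, P X)
  (hPsub : forall X, P X -> @PG R V W n M X)
  (C : Vec R (Sys V W n.+1) M -> Prop) (S : Op R (Sys V W n.+1) -> Prop)
  (hCcl : closedV C) (hCcone : convex_coneV C)
  (hScl : closedO S) (hScvx : convexO S)
  (hCsub : forall X, C X -> CG X)
  (hSsub : forall tau, S tau -> @CombStar R V W n tau)
  (hco : forall X, closureV (convhullV P) X <-> (C X /\ S (sumOp X))) :
  ereal_sup [set (Pval p E X)%:E | X in P]
  = ereal_inf [set DS S chi | chi in DualC p E C].
Proof.
(* A member of [P] is a one-term convex combination, so it lies in the closed hull described by
   [hco]. *)
have P_CS X : P X -> C X /\ S (sumOp X).
  move=> PX; apply/hco => eps eps0; exists X; split; last first.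
    by move=> m i j; rewrite subrr normr0 ltcR.
  exists 1%N, (fun=> 1), (fun=> X).
  by split=> // [|m i j]; rewrite big_ord1 // mul1r.
apply/eqP; rewrite eq_le; apply/andP; split.
  apply: ge_ereal_sup => _ [X PX <-]; apply: le_ereal_inf_tmp => _ [chi Dchi <-].
  by have [CX SX] := P_CS _ PX; exact: weak_duality CX SX Dchi.
have [X0 PX0] := hPne; have [CX0 SX0] := P_CS _ PX0.
have ub X : P X -> ((Pval p E X)%:E <= ereal_sup [set (Pval p E X)%:E | X in P])%E.
  by move=> PX; apply: ereal_sup_ubound; exists X.
(* The value [+oo] is trivial here and [X0] rules out [-oo], so the supremum is a real [v]. *)
case: (ereal_sup _) ub => [v|_|/(_ _ PX0)] //; last by rewrite leey.
move=> ub; apply/lee_addgt0Pr => e e0.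
have [|//|X CX SX|//|chi Dchi chiv] := @strong_duality R V W n M p E C S
  (complex.Re (\prod_(t < n.+1) #|W t.+1|%:R)) v e hCcl hCcone hScl hScvx hCsub.
- by move=> phi /hSsub Sphi; rewrite (CombStar_trace _ _ _ _ _ Sphi); case: Sphi.
- by exists X0.
(* The bound [v] is known on [P] only; [hco] places every feasible point of the relaxed problem in
   the closed hull, where it persists. *)
- apply: (@Pval_le_closure_convhull R V W n M p E P v hp0 _ X); last exact/hco.
  by move=> Y PY; rewrite -lee_fin; exact: ub.
apply: (@le_trans _ _ (DS S chi)); first by apply: ereal_inf_lbound; exists chi.
by apply: ge_ereal_sup => _ [phi Sphi <-]; rewrite -EFinD lee_fin; exact: chiv.
Qed.
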